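(* Let $(x,y,s)\in\mathcal{N}_2(\theta)$ and let $\delta>0$ be an error tolerance. If the sketch-preconditioned conjugate gradient algorithm described in the context is used to compute an approximate solution $\widetilde{\Delta y}$ of the linear system $AD^2A^T\Delta y=p$ to tolerance $\delta$, with number of iterations $$t=\mathcal{O}\left(\log\frac{\sigma_{\max}(AD)\,n\mu}{\delta}\right),$$ then, with probability at least $1-\eta$, $\widetilde{\Delta y}$ satisfies $$\|\widetilde{\Delta y}-(AD^2A^T)^{-1}p\|_{AD^2A^T}\le\delta\qquad\text{and}\qquad\|AD^2A^T\widetilde{\Delta y}-p\|_2\le\delta .$$
   Context: $A\in\mathbb{R}^{m\times n}$ is the constraint matrix of a linear program; it has full row rank $m$ and is short-and-fat ($m\ll n$). $\mathbf{1}_n$ is the all-ones vector, $I_m$ the $m\times m$ identity, $\circ$ the entrywise product, $\|z\|_M=\sqrt{z^TMz}$ for symmetric positive definite $M$, $\|\cdot\|_2$ of a matrix the spectral norm, and $\sigma_{\max}$ the largest singular value. For $(x,y,s)$ with $x,s\in\mathbb{R}^n$ entrywise positive and $y\in\mathbb{R}^m$: $X=\mathrm{diag}(x)$, $S=\mathrm{diag}(s)$, $D=X^{1/2}S^{-1/2}$ (so $D^2=XS^{-1}$), and $\mu=\frac1n x^Ts$ is the duality measure. $\mathcal{N}_2(\theta)=\{(x,y,s):\ \|x\circ s-\mu\mathbf{1}_n\|_2\le\theta\mu,\ (x,s)>0\}$. The right-hand side is $p=-\sigma\mu AS^{-1}\mathbf{1}_n+Ax$, where $\sigma\in[0,1]$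 is the centering parameter. Sketching matrix. Let $AD=U\Sigma V^T$ be a thin SVD ($V\in\mathbb{R}^{n\times m}$ with orthonormal columns). For an accuracy parameter $\zeta\in(0,1)$ and a failure probability $\eta$, $W\in\mathbb{R}^{n\times w}$ is an oblivious sparse random sketching matrix satisfying $\|V^TWW^TV-I_m\|_2\le\zeta/2$ with probability at least $1-\eta$ (such a $W$ exists with $w=\mathcal{O}(\frac{m}{\zeta^2}\log\frac{m}{\eta})$ and $\mathcal{O}(\frac1\zeta\log\frac m\eta)$ nonzero entries per row). Algorithm (inputs $AD$, $p$, failure probability $\eta$, iteration count $t$). Let $Q=ADWW^TDA^T$ and compute $Q^{-1/2}$ from the SVD of $ADW$. Starting from $\tilde z^0=\mathbf{0}_m$, run $t$ iterations of the standard conjugate gradient method on the system $Q^{-1/2}AD^2A^TQ^{-1/2}\tilde z=Q^{-1/2}p$, obtaining $\tilde z^t$, and return $\widetilde{\Delta y}=Q^{-1/2}\tilde z^t$.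
   Formalization: θ is taken in (0,1); the iteration bound is C·max(1, log(σ_max(AD)nμ/δ)), where C depends on θ and on a c>0 with c ≤ nμ and c ≤ σ_max(AD)²nμ; with a uniform constant the claim fails, since scaling A by small k shrinks the log but not the CG error. *)

(* Defs.v *)
From mathcomp Require Export all_boot all_order all_algebra.
From mathcomp Require Export all_classical all_reals all_analysis.

Set Implicit Arguments.
Unset Strict Implicit.
Unset Printing Implicit Defensive.

Import Order.TTheory GRing.Theory Num.Theory.
Local Open Scope classical_set_scope.
Local Open Scope ring_scope.

Section LinearAlgebra.
Variable R : realType.

Definition l2norm n (z : 'cV[R]_n) : R := Num.sqrt (\sum_i z i 0 ^+ 2).

Definition mxnorm m (M : 'M[R]_m) (z : 'cV[R]_m) : R :=
  Num.sqrt ((z^T *m M *m z) 0 0).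

Definition spectral_norm m n (M : 'M[R]_(m, n)) : R :=
  sup [set l2norm (M *m z) | z in [set z : 'cV[R]_n | l2norm z <= 1]].

(* Thin SVD of a matrix with at most as many rows as columns; the entries of
   [sv] are the singular values, in no particular order. *)
Definition thin_svd m n (M : 'M[R]_(m, n))
    (U : 'M[R]_m) (sv : 'rV[R]_m) (V : 'M[R]_(n, m)) : Prop :=
  [/\ U^T *m U = 1%:M, V^T *m V = 1%:M, forall i, 0 <= sv 0 i
    & M = U *m diag_mx sv *m V^T].

(* Singular values are nonnegative, so 0 is a neutral starting value. *)
Definition max_entry m (sv : 'rV[R]_m) : R := \big[Num.max/0]_i sv 0 i.

Definition posdefmx m (M : 'M[R]_m) : Prop :=
  M^T = M /\ forall z : 'cV[R]_m, z != 0 -> 0 < (z^T *m M *m z) 0 0.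

(* Q^{-1/2}: the symmetric positive definite square root of the inverse of Q.
   It is only meaningful for symmetric positive definite Q; the value 0 is
   returned when no such matrix exists. *)
Definition invsqrtmx m (Q : 'M[R]_m) : 'M[R]_m :=
  xget 0 [set B : 'M[R]_m | posdefmx B /\ Q *m (B *m B) = 1%:M].

End LinearAlgebra.

Section ConjugateGradient.
Variables (R : realType) (m : nat).

(* A state is (iterate, residual, search direction). Once the residual
   vanishes, both quotients are 0 / 0 = 0 and the iterate no longer moves. *)
Definition cg_step (M : 'M[R]_m) (st : 'cV[R]_m * 'cV[R]_m * 'cV[R]_m) :
    'cV[R]_m * 'cV[R]_m * 'cV[R]_m :=
  let: (z, r, d) := st in
  let alpha := (r^T *m r) 0 0 / (d^T *m M *m d) 0 0 in
  let z' := z + alpha *: d in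
  let r' := r - alpha *: (M *m d) in
  let beta := (r'^T *m r') 0 0 / (r^T *m r) 0 0 in
  (z', r', r' + beta *: d).

Definition cg (M : 'M[R]_m) (b z0 : 'cV[R]_m) (t : nat) : 'cV[R]_m :=
  (iter t (cg_step M) (z0, b - M *m z0, b - M *m z0)).1.1.

(* Sketch-preconditioned CG with inputs AD and p, sketching matrix W and t
   iterations. *)
Definition sketched_pcg n w (AD : 'M[R]_(m, n)) (W : 'M[R]_(n, w))
    (p : 'cV[R]_m) (t : nat) : 'cV[R]_m :=
  let B := invsqrtmx (AD *m W *m W^T *m AD^T) in
  B *m cg (B *m (AD *m AD^T) *m B) (B *m p) 0 t.

End ConjugateGradient.

Section InteriorPoint.
Variable R : realType.

Definition duality_measure n (x s : 'cV[R]_n) : R :=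
  n%:R^-1 * (x^T *m s) 0 0.

Definition N2 m n (theta : R) : set ('cV[R]_n * 'cV[R]_m * 'cV[R]_n) :=
  [set xys | let: (x, y, s) := xys in
    let mu := duality_measure x s in
    l2norm (map2_mx *%R x s - mu *: const_mx 1) <= theta * mu /\
    forall i, 0 < x i 0 /\ 0 < s i 0].

(* D = X^{1/2} S^{-1/2} *)
Definition scaling n (x s : 'cV[R]_n) : 'M[R]_n :=
  diag_mx (\row_i (Num.sqrt (x i 0) / Num.sqrt (s i 0))).

Definition normal_rhs m n (A : 'M[R]_(m, n)) (sigma : R) (x s : 'cV[R]_n) :
    'cV[R]_m :=
  - (sigma * duality_measure x s) *: (A *m invmx (diag_mx s^T) *m const_mx 1)
  + A *m x.

End InteriorPoint.

Section Probability.
Context d (T : measurableType d) (R : realType) (P : probability T R).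

(* "Phi holds with probability at least q", through a measurable event on
   which Phi holds, so that Phi itself need not be shown measurable; when
   it is, this says exactly that q%:E <= P [set omega | Phi omega]. *)
Definition with_prob_at_least (q : R) (Phi : T -> Prop) : Prop :=
  exists E : set T,
    [/\ measurable E, (q%:E <= P E)%E & forall omega, E omega -> Phi omega].

Definition random_mx n w (W : 'I_n -> 'I_w -> {RV P >-> R}) (omega : T) :
    'M[R]_(n, w) := \matrix_(i, j) W i j omega.

End Probability.

(* Main.v *)
(* Write F = AD and N = F F^T. On the sketching event Q = F W W^T F^T satisfies
   N / 2 <= Q <= 3 N / 2, so the preconditioned matrix has condition number at
   most 3. A conjugate gradient step decreases the squared energy error at least
   as much as a steepest descent step, hence by a factor 2/3. Since p = F v with
   |v|^2 <= (1 + 1 / (1 - theta)) n mu on N2(theta), the initial squared energy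
   error p^T N^-1 p is O(n mu). Finally |N e|_2 <= sigma_max(F) |e|_N transfers
   the energy bound to the residual. *)

Require Import Defs.
From mathcomp Require Import all_boot all_order all_algebra.
From mathcomp.real_closed Require Import complex.
From mathcomp Require Import all_classical all_reals all_analysis.
From mathcomp Require Import ring lra.

Set Implicit Arguments.
Unset Strict Implicit.
Unset Printing Implicit Defensive.

Import Order.TTheory GRing.Theory Num.Theory.
Local Open Scope ring_scope.

(** * Polynomial calculus on symmetric matrices *)

Lemma eigenvalue_similar_diag (F : fieldType) n (A P : 'M[F]_n) (d : 'rV[F]_n) i :
  P \in unitmx -> A = invmx P *m diag_mx d *m P -> eigenvalue A (d 0 i).
Proof.
move=> Pu ->; apply/eigenvalueP; exists (row i P).
  rewrite -row_mul !mulmxA mulmxV // mul1mx row_mul row_diag_mx -scalemxAl.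
  by rewrite -rowE.
(* A zero row [i] would put the [i]-th basis vector in the left kernel of the invertible [P]. *)
apply: contraTneq Pu => Pi0; rewrite -row_free_unit -kermx_eq0.
apply/negP => /eqP k0; have : (delta_mx 0 i : 'rV[F]_n) *m P = 0 by rewrite -rowE.
move/sub_kermxP; rewrite k0 submx0 => /eqP/rowP/(_ i).
by rewrite !mxE !eqxx => /eqP; rewrite oner_eq0.
Qed.

(* Real symmetric matrices are diagonalized over [R[i]], the eigenvalues being
   real; the hypothesis can therefore be checked over [R] only. *)
Lemma horner_mx_symmetric_eq0 (R : rcfType) n (Q : 'M[R]_n.+1) (p : {poly R}) :
  Q^T = Q -> (forall l, eigenvalue Q l -> p.[l] = 0) -> horner_mx Q p = 0.
Proof.
move=> Qsym p0; pose C : numClosedFieldType := complex R.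
pose iota : {rmorphism R -> C} := real_complex R.
pose A : 'M[C]_n.+1 := map_mx iota Q.
have Areal : A \is a realmx.
  apply/mxOverP => i j; rewrite mxE; apply/complex_realP.
  by exists (Q i j).
have Asym : A \is symmetricmx.
  by apply/is_hermitianmxP; rewrite expr0 scale1r; apply/matrixP=> i j;
  rewrite !mxE -[in LHS]Qsym mxE.
have Aherm := realsym_hermsym Asym Areal.
have /orthomx_spectralP := hermitian_normalmx Aherm.
have := hermitian_spectral_diag_real Aherm.
have := spectral_unit A.
move: (spectralmx A) (spectral_diag A) => P d Pu dreal AE.
apply: (map_mx_inj (f := iota)); rewrite map_horner_mx map_mx0.
rewrite -/A AE horner_mx_uconjC //.
rewrite horner_mx_diag (_ : map_mx _ d = 0) ?linear0 ?mulmx0 ?mul0mx //.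
(* Each diagonal entry is real, and it is an eigenvalue of [Q] over [R] because roots of the
   characteristic polynomial are preserved and reflected by the field embedding [iota]. *)
apply/rowP => j; rewrite !mxE.
have /complex_realP[l dl] := mxOverP dreal 0 j.
rewrite dl -[real_complex _ _]/(iota l) horner_map p0 ?rmorph0 //.
have := eigenvalue_similar_diag j Pu AE.
rewrite dl !eigenvalue_root_char -map_char_poly.
by rewrite -[real_complex _ _]/(iota l) fmorph_root.
Qed.

(** Newton's scheme: a new node is handled by adding a multiple of the polynomial that vanishes at
    all earlier nodes. It lets a function of a matrix be realized as a polynomial in it. *)
Lemma poly_interpolation (F : fieldType) (f : F -> F) (s : seq F) :
  exists p : {poly F}, forall x, x \in s -> p.[x] = f x.
Proof.
elim: s => [|a s [p IH]]; first by exists 0.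
have [sa|sa] := boolP (a \in s).
  by exists p => x; rewrite inE => /predU1P[->|]; apply: IH.
pose q := \prod_(b <- s) ('X - b%:P).
have qa : q.[a] != 0 by rewrite -[_ == _]/(root q a) root_prod_XsubC.
exists (p + ((f a - p.[a]) / q.[a])%:P * q) => x.
rewrite inE hornerD hornerM hornerC => /predU1P[->|xs].
  by rewrite divfK // addrC subrK.
have /eqP-> : root q x by rewrite root_prod_XsubC.
by rewrite mulr0 addr0 IH.
Qed.

Lemma trmx_horner_mx (K : comNzRingType) n (A : 'M[K]_n.+1) p :
  A^T = A -> (horner_mx A p)^T = horner_mx A p.
Proof.
move=> Asym; elim/poly_ind: p => [|p c IH]; first by rewrite rmorph0 trmx0.
rewrite rmorphD rmorphM /= horner_mx_X horner_mx_C linearD /= tr_scalar_mx.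
congr (_ + _); rewrite trmx_mul Asym IH.
by apply: comm_mx_horner.
Qed.

(** * Inner product and positive definite matrices *)

Section DotProduct.
Variable R : realType.

Definition dotp n (u v : 'cV[R]_n) : R := (u^T *m v) 0 0.

Lemma dotpE n (u v : 'cV[R]_n) : dotp u v = \sum_i u i 0 * v i 0.
Proof. by rewrite /dotp mxE; apply: eq_bigr => i _; rewrite mxE. Qed.

Lemma dotpC n (u v : 'cV[R]_n) : dotp u v = dotp v u.
Proof. by rewrite !dotpE; apply: eq_bigr => i _; rewrite mulrC. Qed.

Lemma dotpDr n (u v w : 'cV[R]_n) : dotp u (v + w) = dotp u v + dotp u w.
Proof. by rewrite /dotp mulmxDr mxE. Qed.

Lemma dotpZr n a (u v : 'cV[R]_n) : dotp u (a *: v) = a * dotp u v.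
Proof. by rewrite /dotp -scalemxAr mxE. Qed.

Lemma dotpDl n (u v w : 'cV[R]_n) : dotp (v + w) u = dotp v u + dotp w u.
Proof. by rewrite !(dotpC _ u) dotpDr. Qed.

Lemma dotpZl n a (u v : 'cV[R]_n) : dotp (a *: v) u = a * dotp v u.
Proof. by rewrite !(dotpC _ u) dotpZr. Qed.

Lemma dotpNr n (u v : 'cV[R]_n) : dotp u (- v) = - dotp u v.
Proof. by rewrite -scaleN1r dotpZr mulN1r. Qed.

Lemma dotpNl n (u v : 'cV[R]_n) : dotp (- v) u = - dotp v u.
Proof. by rewrite !(dotpC _ u) dotpNr. Qed.

Lemma dotp0 n (u : 'cV[R]_n) : dotp u 0 = 0.
Proof. by rewrite /dotp mulmx0 mxE. Qed.

Definition dotp_lin := (dotpDl, dotpDr, dotpZl, dotpZr, dotpNl, dotpNr).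

Lemma dotp_mull n k (A : 'M[R]_(k, n)) u v : dotp (A *m u) v = dotp u (A^T *m v).
Proof. by rewrite /dotp trmx_mul mulmxA. Qed.

Lemma dotp_sym_mx n (A : 'M[R]_n) u v :
  A^T = A -> dotp u (A *m v) = dotp v (A *m u).
Proof. by move=> Asym; rewrite dotpC dotp_mull Asym. Qed.

Lemma dotp_ge0 n (u : 'cV[R]_n) : 0 <= dotp u u.
Proof. by rewrite dotpE sumr_ge0 // => i _; rewrite -expr2 sqr_ge0. Qed.

Lemma dotp_eq0 n (u : 'cV[R]_n) : (dotp u u == 0) = (u == 0).
Proof.
apply/idP/eqP => [|->]; last by rewrite dotp0.
rewrite dotpE psumr_eq0 => [/allP u0|i _]; last by rewrite -expr2 sqr_ge0.
apply/colP => i; have := u0 i (mem_index_enum i).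
by rewrite /= mulf_eq0 orbb mxE => /eqP.
Qed.

Lemma dotp_gt0 n (u : 'cV[R]_n) : u != 0 -> 0 < dotp u u.
Proof. by move=> u0; rewrite lt_neqAle eq_sym dotp_eq0 u0 dotp_ge0. Qed.

Lemma dotp_CauchySchwarz n (u v : 'cV[R]_n) :
  dotp u v ^+ 2 <= dotp u u * dotp v v.
Proof.
have [->|u0] := eqVneq u 0; first by rewrite dotpC !dotp0 expr0n mul0r.
(* The component of [v] orthogonal to [u], scaled by [dotp u u] to avoid a division. *)
have := dotp_ge0 (dotp u u *: v - dotp u v *: u).
rewrite !dotp_lin (dotpC v u).
have := dotp_gt0 u0; move: (dotp u u) (dotp u v) (dotp v v) => a b c a0.
move=> h; rewrite -subr_ge0 -(pmulr_rge0 _ a0); move: h.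
by congr (0 <= _); ring.
Qed.

Lemma l2normE n (z : 'cV[R]_n) : l2norm z = Num.sqrt (dotp z z).
Proof.
by rewrite /l2norm dotpE; congr Num.sqrt; apply: eq_bigr => i _; rewrite expr2.
Qed.

Lemma mxnormE n (M : 'M[R]_n) z : mxnorm M z = Num.sqrt (dotp z (M *m z)).
Proof. by rewrite /mxnorm /dotp mulmxA. Qed.

Lemma posdefmxE n (M : 'M[R]_n) :
  posdefmx M <-> M^T = M /\ forall z, z != 0 -> 0 < dotp z (M *m z).
Proof.
by split=> -[MT Mp]; split=> // z /Mp; rewrite /dotp mulmxA.
Qed.

Lemma posdefmx_ge0 n (M : 'M[R]_n) z : posdefmx M -> 0 <= dotp z (M *m z).
Proof.
move=> /posdefmxE[_ Mp]; have [->|/Mp/ltW//] := eqVneq z 0.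
by rewrite dotpC dotp0.
Qed.

Lemma posdefmx_eq0 n (M : 'M[R]_n) z :
  posdefmx M -> dotp z (M *m z) = 0 -> z = 0.
Proof.
move=> /posdefmxE[_ Mp] Mz; have [//|/Mp] := eqVneq z 0.
by rewrite Mz ltxx.
Qed.

Lemma mulmx_inj_unitmx n (M : 'M[R]_n) :
  (forall z : 'cV_n, M *m z = 0 -> z = 0) -> M \in unitmx.
Proof.
move=> Minj; rewrite -unitmx_tr -row_free_unit -kermx_eq0.
apply/eqP/row_matrixP => i; rewrite row0; apply: trmx_inj.
rewrite trmx0; apply: Minj; apply: trmx_inj.
by rewrite trmx_mul trmxK -row_mul mulmx_ker row0 trmx0.
Qed.

Lemma posdefmx_unit n (M : 'M[R]_n) : posdefmx M -> M \in unitmx.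
Proof.
move=> Mpd; apply: mulmx_inj_unitmx => z Mz; apply: (posdefmx_eq0 Mpd).
by rewrite Mz dotp0.
Qed.

End DotProduct.

(** * Existence of the inverse square root *)

Section InverseSquareRoot.
Variable R : realType.

Lemma posdefmx_eigenvalue_gt0 n (Q : 'M[R]_n) l :
  posdefmx Q -> eigenvalue Q l -> 0 < l.
Proof.
move=> /posdefmxE[Qsym Qp] /eigenvalueP[v vQ v0].
have vT0 : v^T != 0 by rewrite -trmx0 (inj_eq trmx_inj).
have := Qp _ vT0; rewrite -[Q in Q *m _]Qsym -trmx_mul vQ linearZ /= dotpZr.
by rewrite pmulr_lgt0 // dotp_gt0.
Qed.

(* [B = g(Q) ^+ 2] with [g(l) = l^(-1/4)] on the spectrum of [Q]: being a square
   makes [B] positive definite. *)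
Lemma posdefmx_invsqrt n (Q : 'M[R]_n) :
  posdefmx Q -> exists B, posdefmx B /\ Q *m (B *m B) = 1%:M.
Proof.
(* [horner_mx] requires a nonempty matrix, so size 0 is treated apart. *)
case: n Q => [|n] Q Qpd.
  exists 0; split; last by apply/matrixP => -[].
  by split=> [|z]; [rewrite trmx0|rewrite flatmx0 eqxx].
have [Qsym _] := Qpd.
(* A finite list of interpolation nodes: the real parts of all complex roots of the characteristic
   polynomial. *)
have [s sP] : exists s : seq R, forall l, eigenvalue Q l -> l \in s.
  have cp0 : char_poly Q != 0 by rewrite monic_neq0 // char_poly_monic.
  have [s sP] := closed_field_poly_normal (map_poly (real_complex R) (char_poly Q)).
  exists [seq complex.Re z | z <- s] => l; rewrite eigenvalue_root_char => Ql.
  suff : real_complex R l \in s by move=> /(map_f (@complex.Re R)).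
  rewrite -root_prod_XsubC.
  have : root (map_poly (real_complex R) (char_poly Q)) (real_complex R l).
    by rewrite fmorph_root.
  by rewrite sP rootZ // lead_coef_eq0 map_poly_eq0.
have [g gP] := poly_interpolation (fun l => Num.sqrt (Num.sqrt l^-1)) s.
pose H := horner_mx Q g.
have HT : H^T = H by exact: trmx_horner_mx.
(* As a polynomial identity in [Q], this only has to hold at the eigenvalues, where it reads [l *
   g.[l] ^+ 4 = 1]. *)
have QH4 : Q *m ((H *m H) *m (H *m H)) = 1%:M.
  apply/eqP; rewrite -subr_eq0; apply/eqP.
  transitivity (horner_mx Q ('X * (g * g * (g * g)) - 1)).
    by rewrite rmorphB !rmorphM /= horner_mx_X (rmorph1 (horner_mx Q)).
  apply: horner_mx_symmetric_eq0 => // l Ql.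
  have l0 := posdefmx_eigenvalue_gt0 Qpd Ql.
  have gl : g.[l] ^+ 4 = l^-1.
    by rewrite gP ?sP // (exprM _ 2 2) !sqr_sqrtr ?sqrtr_ge0 // invr_ge0 ltW.
  have -> : ('X * (g * g * (g * g)) - 1).[l] = l * g.[l] ^+ 4 - 1.
    by rewrite !hornerE; ring.
  by rewrite gl mulfV ?gt_eqF // subrr.
exists (H *m H); split=> //; apply/posdefmxE; split.
  by rewrite trmx_mul HT.
(* The form at [z] is the squared norm of [H *m z], and [H] is injective since its fourth power is
   inverse to [Q]. *)
move=> z z0; rewrite -mulmxA -[H in dotp _ (H *m _)]HT -dotp_mull dotp_gt0 //.
apply: contra_neq z0 => Hz.
have /mulmx1C : Q *m ((H *m H) *m (H *m H)) = 1%:M by [].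
move=> /(congr1 (mulmx^~ z)); rewrite mul1mx => <-.
have -> : (H *m H) *m (H *m H) *m Q = Q *m ((H *m H) *m (H *m H)).
  by rewrite QH4; apply: mulmx1C.
by rewrite -!mulmxA Hz !mulmx0.
Qed.

Lemma invsqrtmxP n (Q : 'M[R]_n) : posdefmx Q ->
  posdefmx (invsqrtmx Q) /\ Q *m (invsqrtmx Q *m invsqrtmx Q) = 1%:M.
Proof. by move=> /posdefmx_invsqrt; apply: xgetPex. Qed.

End InverseSquareRoot.

(** * Linear convergence of conjugate gradients *)

Section ConjugateGradientConvergence.
Variables (R : realType) (m : nat) (M : 'M[R]_m) (b zs : 'cV[R]_m).
Hypothesis Mpd : posdefmx M.
Hypothesis Mzs : M *m zs = b.

Let energy z := dotp (z - zs) (M *m (z - zs)).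

(* These local relations replace the usual global orthogonality and conjugacy
   relations: they suffice to compare a step with steepest descent. *)
Definition cg_invariant (st : 'cV[R]_m * 'cV[R]_m * 'cV[R]_m) : Prop :=
  let: (z, r, d) := st in
  [/\ r = b - M *m z, dotp r d = dotp r r, dotp d (M *m d) = dotp d (M *m r)
    & dotp d (M *m d) <= dotp r (M *m r)].

Lemma cg_invariant_init z : cg_invariant (z, b - M *m z, b - M *m z).
Proof. by split. Qed.

(** The choice of [alpha] makes the new residual r' orthogonal to both [d] and [r]; then [beta]
    makes the new direction M-conjugate to [d]. By conjugacy the new direction has energy r'.Mr' -
    beta^2 d.Md, which yields the last two relations. *)
Lemma cg_invariant_step st : cg_invariant st -> cg_invariant (cg_step M st).
Proof.
move: st => [[z r] d] [rE rd dd dle] /=.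
have [MT _] := Mpd.
rewrite -![(_^T *m _) 0 0]/(dotp _ _) -mulmxA -[(_^T *m (M *m d)) 0 0]/(dotp _ _).
(* A zero residual forces a zero direction, and the state is then a fixed point. *)
have [r0|r0] := eqVneq r 0.
  have d0 : d = 0 by apply: (posdefmx_eq0 Mpd); rewrite dd r0 mulmx0 dotp0.
  rewrite d0 mulmx0 !scaler0 !addr0 oppr0 addr0.
  by split.
have rr0 := dotp_gt0 r0.
have d0 : d != 0.
  by apply: contraTneq rr0 => d0; rewrite -rd d0 dotp0 ltxx.
have dd0 : 0 < dotp d (M *m d) by have /posdefmxE[_ ->] := Mpd.
set al := dotp r r / _; move r'E : (r - _) => r'.
have al0 : al != 0 by rewrite gt_eqF // divr_gt0.
have r'd : dotp r' d = 0.
  by rewrite -r'E !dotp_lin rd (dotpC (M *m d)) /al divfK ?gt_eqF // subrr.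
have r'r : dotp r' r = 0.
  rewrite -r'E !dotp_lin (dotpC (M *m d)) (dotp_sym_mx r d MT) -dd.
  by rewrite /al divfK ?gt_eqF // subrr.
(* The residual update expresses [M *m d] through [r - r'], where [r] is orthogonal to [r']. *)
have r'Md : dotp r' (M *m d) = - (dotp r' r' / al).
  have -> : M *m d = al^-1 *: (r - r').
    by rewrite -r'E opprB addrC subrK scalerA mulVf // scale1r.
  by rewrite !dotp_lin r'r; ring.
set be := dotp r' r' / dotp r r.
have conj : dotp r' (M *m d) + be * dotp d (M *m d) = 0.
  rewrite r'Md /be /al invf_div; field.
  by rewrite !gt_eqF.
have {}r'Md : dotp r' (M *m d) = - (be * dotp d (M *m d)).
  by apply/eqP; rewrite -addr_eq0 conj.
have dMr' : dotp d (M *m r') = - (be * dotp d (M *m d)).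
  by rewrite (dotp_sym_mx d r' MT).
split.
- by rewrite -r'E rE mulmxDr -scalemxAr opprD addrA.
- by rewrite !dotp_lin r'd; ring.
- by rewrite mulmxDr -scalemxAr !dotp_lin r'Md dMr'; ring.
- rewrite mulmxDr -scalemxAr !dotp_lin r'Md dMr'.
  have : 0 <= be ^+ 2 * dotp d (M *m d) by rewrite mulr_ge0 ?sqr_ge0 // ltW.
  by rewrite expr2; lra.
Qed.

Variables lo hi : R.
Hypothesis lohi : 0 < lo <= hi.
Hypothesis Mlo : forall y, lo * dotp y (M *m y) <= dotp y y.
Hypothesis Mhi : forall y, dotp y y <= hi * dotp y (M *m y).

(** The bounds place the spectrum of [M] in [1/hi, 1/lo]. The exact line search lowers the energy by
    (r.r)^2 / d.Md, and d.Md <= r.Mr makes this at least the steepest descent decrease. *)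
Lemma cg_step_energy st : cg_invariant st ->
  energy (cg_step M st).1.1 <= (1 - lo / hi) * energy st.1.1.
Proof.
move: st => [[z r] d] [rE rd dd dle] /=.
have [MT _] := Mpd.
have [lo0 lehi] := andP lohi; have hi0 := lt_le_trans lo0 lehi.
rewrite -![(_^T *m _) 0 0]/(dotp _ _) -mulmxA -[(_^T *m (M *m d)) 0 0]/(dotp _ _).
have rE' : r = - (M *m (z - zs)) by rewrite mulmxBr Mzs opprB.
rewrite /energy addrAC; move: (z - zs) rE' => e {}rE.
have Me : M *m e = - r by rewrite rE opprK.
have [r0|r0] := eqVneq r 0.
  have e0 : e = 0 by apply: (posdefmx_eq0 Mpd); rewrite Me r0 oppr0 dotp0.
  have d0 : d = 0 by apply: (posdefmx_eq0 Mpd); rewrite dd r0 mulmx0 dotp0.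
  by rewrite e0 d0 scaler0 addr0 mulmx0 dotp0 mulr0.
have rr0 := dotp_gt0 r0.
have d0 : d != 0.
  by apply: contraTneq rr0 => d0; rewrite -rd d0 dotp0 ltxx.
have dd0 : 0 < dotp d (M *m d) by have /posdefmxE[_ ->] := Mpd.
set al := dotp r r / _.
have -> : dotp (e + al *: d) (M *m (e + al *: d)) =
    dotp e (M *m e) - dotp r r ^+ 2 / dotp d (M *m d).
  rewrite mulmxDr -scalemxAr !dotp_lin (dotp_sym_mx e d MT) Me !dotp_lin.
  rewrite (dotpC d r) rd /al; field.
  by rewrite gt_eqF.
set E := dotp e (M *m e).
have E0 : 0 < E.
  have /posdefmxE[_ ->] // := Mpd.
  by apply: contra_neq r0 => e0; rewrite rE e0 mulmx0 oppr0.
(* Since [M *m e = - r], Cauchy-Schwarz gives E^2 <= (e.e)(r.r) <= hi E (r.r); divide by E. *)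
have Ehi : E <= hi * dotp r r.
  have CS := dotp_CauchySchwarz e (M *m e).
  rewrite -(ler_pM2l E0) -expr2.
  have rrE : dotp (M *m e) (M *m e) = dotp r r by rewrite Me !dotp_lin opprK.
  rewrite rrE in CS; apply: (le_trans CS).
  by rewrite mulrA (mulrC E) ler_pM2r // -/E Mhi.
(* Here d.Md <= r.Mr <= (r.r) / lo. *)
have drop : lo * dotp r r <= dotp r r ^+ 2 / dotp d (M *m d).
  rewrite ler_pdivlMr // expr2 mulrAC -mulrA (mulrC (dotp r r)) mulrA.
  rewrite ler_pM2r //; apply: le_trans (Mlo r).
  by rewrite ler_pM2l.
have : lo / hi * E <= lo * dotp r r by rewrite -mulrA ler_pM2l // ler_pdivrMl.
by move: drop; move: (dotp r r ^+ 2 / _) => a; lra.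
Qed.

Lemma cg_convergence t :
  energy (cg M b 0 t) <= (1 - lo / hi) ^+ t * dotp zs (M *m zs).
Proof.
have [lo0 lehi] := andP lohi; have hi0 := lt_le_trans lo0 lehi.
have q0 : 0 <= 1 - lo / hi by rewrite subr_ge0 ler_pdivrMr // mul1r.
rewrite /cg; set st0 := (_, _, _).
have inv t' : cg_invariant (iter t' (cg_step M) st0).
  elim: t' => [|t' IH]; first exact: cg_invariant_init.
  exact: cg_invariant_step.
elim: t => [|t IH] /=.
  by rewrite expr0 mul1r /energy sub0r mulmxN !dotp_lin opprK.
apply: le_trans (cg_step_energy (inv t)) _.
by rewrite exprS -mulrA ler_wpM2l.
Qed.

End ConjugateGradientConvergence.

(** * Euclidean and spectral norms *)

Section MatrixNorms.
Variable R : realType.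

Lemma l2norm_ge0 n (u : 'cV[R]_n) : 0 <= l2norm u.
Proof. exact: sqrtr_ge0. Qed.

Lemma sqr_l2norm n (u : 'cV[R]_n) : l2norm u ^+ 2 = dotp u u.
Proof. by rewrite l2normE sqr_sqrtr ?dotp_ge0. Qed.

Lemma normr_dotp_le n (u v : 'cV[R]_n) : `|dotp u v| <= l2norm u * l2norm v.
Proof.
rewrite -(ler_pXn2r (ltn0Sn 1)) ?nnegrE ?mulr_ge0 ?l2norm_ge0 //.
by rewrite exprMn !sqr_l2norm real_normK ?num_real // dotp_CauchySchwarz.
Qed.

Lemma normr_entry_le_l2norm n (u : 'cV[R]_n) i : `|u i 0| <= l2norm u.
Proof.
rewrite -(ler_pXn2r (ltn0Sn 1)) ?nnegrE ?l2norm_ge0 // sqr_l2norm.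
rewrite real_normK ?num_real // dotpE (bigD1 i) //= -expr2 lerDl sumr_ge0 // => j _.
by rewrite -expr2 sqr_ge0.
Qed.

(** Cauchy-Schwarz on each row gives the Frobenius norm as a bound. Boundedness is what makes the
    [sup] in [spectral_norm] an actual upper bound. *)
Lemma mulmx_l2norm_bounded m n (A : 'M[R]_(m, n)) :
  exists K, forall z, l2norm z <= 1 -> l2norm (A *m z) <= K.
Proof.
exists (Num.sqrt (\sum_i dotp (row i A)^T (row i A)^T)) => z z1.
rewrite l2normE; apply: ler_wsqrtr; rewrite dotpE; apply: ler_sum => i _.
have -> : (A *m z) i 0 = dotp (row i A)^T z.
  by rewrite dotpE mxE; apply: eq_bigr => j _; rewrite !mxE.
rewrite -expr2; apply: le_trans (dotp_CauchySchwarz _ _) _.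
rewrite -[leRHS]mulr1 ler_wpM2l ?dotp_ge0 // -sqr_l2norm.
by rewrite exprn_ile1 ?l2norm_ge0.
Qed.

Lemma l2norm_mulmx_le m n (A : 'M[R]_(m, n)) z :
  l2norm (A *m z) <= spectral_norm A * l2norm z.
Proof.
have [->|z0] := eqVneq z 0; first by rewrite mulmx0 !l2normE !dotp0 sqrtr0 mulr0.
have nz0 : 0 < l2norm z by rewrite l2normE sqrtr_gt0 dotp_gt0.
have scale a k (v : 'cV[R]_k) : 0 <= a -> l2norm (a *: v) = a * l2norm v.
  move=> a0; rewrite !l2normE !dotp_lin mulrA -expr2 sqrtrM ?sqr_ge0 //.
  by rewrite sqrtr_sqr ger0_norm.
have iz0 : 0 <= (l2norm z)^-1 by rewrite invr_ge0 ltW.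
rewrite -ler_pdivrMr // mulrC -scale // scalemxAr.
have z1 : l2norm ((l2norm z)^-1 *: z) <= 1.
  by rewrite scale // mulVf ?gt_eqF.
apply: ub_le_sup; last by exists ((l2norm z)^-1 *: z).
have [K KP] := mulmx_l2norm_bounded A.
by exists K => _ [v v1 <-]; apply: KP.
Qed.

Lemma normr_quadratic_form_le n (H : 'M[R]_n) u :
  `|dotp u (H *m u)| <= spectral_norm H * dotp u u.
Proof.
apply: le_trans (normr_dotp_le _ _) _.
rewrite mulrC -sqr_l2norm expr2 mulrA ler_wpM2r ?l2norm_ge0 //.
exact: l2norm_mulmx_le.
Qed.

End MatrixNorms.

(** * Change of variables by the preconditioner *)

Lemma preconditioned_cg_convergence (R : realType) m (N Q : 'M[R]_m)
    (p : 'cV[R]_m) (lo hi : R) t :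
  posdefmx N -> Q^T = Q -> 0 < lo <= hi ->
  (forall z, lo * dotp z (N *m z) <= dotp z (Q *m z)) ->
  (forall z, dotp z (Q *m z) <= hi * dotp z (N *m z)) ->
  let B := invsqrtmx Q in
  let e := B *m cg (B *m N *m B) (B *m p) 0 t - invmx N *m p in
  dotp e (N *m e) <= (1 - lo / hi) ^+ t * dotp p (invmx N *m p).
Proof.
move=> Npd QT lohi Qlo Qhi /=.
have [/posdefmxE[NT Np] Nu] := (Npd, posdefmx_unit Npd).
have Qpd : posdefmx Q.
  apply/posdefmxE; split=> // z z0; apply: lt_le_trans (Qlo z).
  by rewrite mulr_gt0 ?Np //; case/andP: lohi.
have [Bpd QBB] := invsqrtmxP Qpd.
move: (invsqrtmx Q) Bpd QBB => B Bpd QBB.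
have [[BT _] Bu] := (Bpd, posdefmx_unit Bpd).
have BQB : B *m Q *m B = 1%:M by rewrite -mulmxA; apply: mulmx1C; rewrite -mulmxA.
set M := B *m N *m B.
(* The substitution z = B y carries the [M]-form to the [N]-form and, as B Q B = 1, the Euclidean
   form to the [Q]-form. Comparing [Q] with [N] is therefore the spectral bound on [M] that
   conjugate gradients need. *)
have ME y : dotp y (M *m y) = dotp (B *m y) (N *m (B *m y)).
  by rewrite dotp_mull BT /M !mulmxA.
have yyE (y : 'cV_m) : dotp y y = dotp (B *m y) (Q *m (B *m y)).
  by rewrite dotp_mull BT !mulmxA BQB mul1mx.
have Mpd : posdefmx M.
  apply/posdefmxE; split; first by rewrite !trmx_mul BT NT mulmxA.
  move=> y y0; rewrite ME Np //; apply: contra_neq y0 => By0.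
  by rewrite -(mulKmx Bu y) By0 mulmx0.
pose zs := invmx B *m (invmx N *m p).
have Bzs : B *m zs = invmx N *m p by rewrite mulKVmx.
have Mzs : M *m zs = B *m p by rewrite /M -!mulmxA Bzs mulKVmx.
have lo' y : lo * dotp y (M *m y) <= dotp y y by rewrite ME yyE.
have hi' y : dotp y y <= hi * dotp y (M *m y) by rewrite ME yyE.
have := cg_convergence Mpd Mzs lohi lo' hi' t.
rewrite !ME mulmxBr Bzs mulKVmx // => h; apply: (le_trans h).
by rewrite dotpC.
Qed.

(** * Quadratic forms through the thin SVD *)

Section Svd.
Variables (R : realType) (m n : nat) (F : 'M[R]_(m, n)).
Variables (U : 'M[R]_m) (sv : 'rV[R]_m) (V : 'M[R]_(n, m)).
Hypothesis Fsvd : thin_svd F U sv V.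

(** The coordinates of F^T z in the orthonormal columns of [V]; their Euclidean norm is the energy
    norm of [z]. *)
Let scaled (z : 'cV_m) := diag_mx sv *m (U^T *m z).

Lemma thin_svd_trmulmx (z : 'cV_m) : F^T *m z = V *m scaled z.
Proof.
by have [_ _ _ ->] := Fsvd; rewrite !trmx_mul trmxK tr_diag_mx !mulmxA.
Qed.

Lemma thin_svd_gram (z : 'cV_m) : dotp z (F *m F^T *m z) = dotp (scaled z) (scaled z).
Proof.
have [_ VV _ _] := Fsvd.
rewrite -mulmxA -[F in F *m _]trmxK -dotp_mull thin_svd_trmulmx dotp_mull.
by rewrite mulmxA VV mul1mx.
Qed.

Lemma max_entry_ge i : sv 0 i <= max_entry sv.
Proof. by rewrite /max_entry le_bigmax. Qed.

Lemma max_entry_ge0 : 0 <= max_entry sv.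
Proof. by rewrite /max_entry bigmax_ge_id. Qed.

(** With u = [scaled z], F F^T z equals U diag(sv) u, and [U] preserves norms, so each u_i is
    multiplied by at most the largest singular value. *)
Lemma thin_svd_residual (z : 'cV_m) :
  dotp (F *m F^T *m z) (F *m F^T *m z) <=
  max_entry sv ^+ 2 * dotp z (F *m F^T *m z).
Proof.
have [UU VV sv0 FE] := Fsvd.
rewrite thin_svd_gram -mulmxA thin_svd_trmulmx [X in X *m _]FE.
rewrite -(mulmxA _ V^T) (mulmxA V^T) VV mul1mx -(mulmxA U) dotp_mull mulmxA UU mul1mx.
move: (scaled z) => u; rewrite !dotpE mulr_sumr; apply: ler_sum => i _.
rewrite mul_diag_mx !mxE -!expr2 exprMn ler_wpM2r ?sqr_ge0 //.
by rewrite lerXn2r ?nnegrE ?max_entry_ge0 ?max_entry_ge.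
Qed.

(** Since F^T z = V u with u = [scaled z], the difference is the quadratic form of V^T W W^T V - 1
    at u. *)
Lemma sketch_distortion w (W : 'M[R]_(n, w)) (z : 'cV_m) :
  `|dotp z (F *m W *m W^T *m F^T *m z) - dotp z (F *m F^T *m z)| <=
  spectral_norm (V^T *m W *m W^T *m V - 1%:M) * dotp z (F *m F^T *m z).
Proof.
rewrite thin_svd_gram.
have -> : dotp z (F *m W *m W^T *m F^T *m z) =
    dotp (scaled z) (V^T *m W *m W^T *m V *m scaled z).
  rewrite -!mulmxA -[F in F *m _]trmxK -dotp_mull thin_svd_trmulmx dotp_mull.
  by rewrite !mulmxA.
move: (scaled z) => u; rewrite -[X in `|_ - dotp _ X|](mul1mx u) -dotpNr -dotpDr -mulmxBl.
exact: normr_quadratic_form_le.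
Qed.

(** The left side is the squared norm of F^T (F F^T)^-1 F v, the orthogonal projection of [v] onto
    the row space of [F]. *)
Lemma dotp_invmx_gram_le (v : 'cV_n) : posdefmx (F *m F^T) ->
  dotp (F *m v) (invmx (F *m F^T) *m (F *m v)) <= dotp v v.
Proof.
move=> Npd; have Nu := posdefmx_unit Npd.
set q := invmx _ *m _; have Nq : F *m F^T *m q = F *m v by rewrite mulKVmx.
have aE : dotp (F *m v) q = dotp (F^T *m q) (F^T *m q).
  by rewrite -Nq dotpC -mulmxA -[F in F *m _]trmxK -dotp_mull.
have := dotp_CauchySchwarz v (F^T *m q); rewrite -dotp_mull aE expr2.
have [->|/dotp_gt0 a0] := eqVneq (F^T *m q) 0; first by rewrite !dotp0 dotp_ge0.
by rewrite ler_pM2r.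
Qed.

End Svd.

(** * Size of the right-hand side on the neighborhood *)

Section NormalEquations.
Variable R : realType.

Lemma gram_posdefmx m n (F : 'M[R]_(m, n)) : row_free F -> posdefmx (F *m F^T).
Proof.
move=> Ffree; apply/posdefmxE; split; first by rewrite trmx_mul trmxK.
move=> z z0; rewrite -mulmxA -[F in F *m _]trmxK -dotp_mull dotp_gt0 //.
rewrite -trmx0 -[z]trmxK -trmx_mul (inj_eq trmx_inj) mulmx_free_eq0 //.
by rewrite -trmx0 (inj_eq trmx_inj).
Qed.

Lemma diag_mx_unit n (d : 'rV[R]_n) : (forall i, d 0 i != 0) -> diag_mx d \in unitmx.
Proof. by move=> d0; rewrite unitmxE det_diag unitfE; apply/prodf_neq0. Qed.

Section Point.
Variables (n : nat) (x s : 'cV[R]_n).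
Hypotheses (x0 : forall i, 0 < x i 0) (s0 : forall i, 0 < s i 0).

Lemma tr_scaling : (scaling x s)^T = scaling x s.
Proof. exact: tr_diag_mx. Qed.

Lemma scaling_unit : scaling x s \in unitmx.
Proof.
apply: diag_mx_unit => i; rewrite mxE mulf_neq0 ?invr_eq0 //;
by rewrite gt_eqF // sqrtr_gt0.
Qed.

Lemma row_free_scaling m (A : 'M[R]_(m, n)) :
  row_free A -> row_free (A *m scaling x s).
Proof. by move=> Af; rewrite /row_free mxrankMfree // row_free_unit scaling_unit. Qed.

Let mu := duality_measure x s.

(** Chosen so that D v = x - sigma mu S^-1 1, which factors the right-hand side through A D. *)
Let v sigma : 'cV[R]_n :=
  \col_i (Num.sqrt (x i 0) * Num.sqrt (s i 0)
          - sigma * mu / (Num.sqrt (x i 0) * Num.sqrt (s i 0))).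

Lemma normal_rhsE m (A : 'M[R]_(m, n)) sigma :
  normal_rhs A sigma x s = A *m scaling x s *m v sigma.
Proof.
pose si : 'cV[R]_n := \col_i (s i 0)^-1.
have Ssi : invmx (diag_mx s^T) *m const_mx 1 = si.
  have -> : const_mx 1 = diag_mx s^T *m si.
    by apply/colP => i; rewrite mul_diag_mx !mxE mulfV // gt_eqF.
  by rewrite mulKmx // diag_mx_unit // => i; rewrite mxE gt_eqF.
rewrite /normal_rhs -!mulmxA Ssi scalemxAr -mulmxDr; congr (_ *m _).
apply/colP => i; rewrite mul_diag_mx !mxE -/mu.
have [rx rs] : 0 < Num.sqrt (x i 0) /\ 0 < Num.sqrt (s i 0) by rewrite !sqrtr_gt0.
rewrite -[x i 0 in LHS]sqr_sqrtr 1?ltW // -[s i 0 in LHS]sqr_sqrtr 1?ltW //.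
by field; rewrite !gt_eqF.
Qed.

(** A squared entry is x_i s_i - 2 sigma mu + (sigma mu)^2 / (x_i s_i). The first terms sum to n mu,
    the second are dropped, and the third are at most mu / (1 - theta) because x_i s_i >= (1 -
    theta) mu. *)
Lemma dotp_normal_rhs_le (theta sigma : R) : theta < 1 -> 0 <= sigma <= 1 ->
  0 < mu -> l2norm (map2_mx *%R x s - mu *: const_mx 1) <= theta * mu ->
  dotp (v sigma) (v sigma) <= (1 + (1 - theta)^-1) * (n%:R * mu).
Proof.
move=> theta1 /andP[sig0 sig1] mu0 near.
have xs_ge i : (1 - theta) * mu <= x i 0 * s i 0.
  have := le_trans (normr_entry_le_l2norm _ i) near.
  by rewrite !mxE mulr1 ler_norml => /andP[]; lra.
have th0 : 0 < 1 - theta by rewrite subr_gt0.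
have nmu : n%:R * mu = \sum_i x i 0 * s i 0.
  rewrite /mu /duality_measure -[(_ *m _) 0 0]/(dotp x s) dotpE.
  case: (posnP n) x s => [->|n0] ? ?; first by rewrite mul0r big_ord0.
  by rewrite mulrA mulfV ?mul1r // pnatr_eq0 -lt0n.
rewrite mulrDl mul1r {1}nmu mulrCA -[n in n%:R]card_ord -sum1_card natr_sum.
rewrite mulr_suml -big_split dotpE; apply: ler_sum => i _ /=.
rewrite mul1r !mxE -expr2.
have xs0 : 0 < x i 0 * s i 0 by rewrite mulr_gt0.
rewrite -sqrtrM ?(ltW (x0 i)) //; have := sqr_sqrtr (ltW xs0).
have : 0 < Num.sqrt (x i 0 * s i 0) by rewrite sqrtr_gt0.
move: (Num.sqrt _) => r r0 r2.
have -> : (r - sigma * mu / r) ^+ 2 =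
    r ^+ 2 - 2 * (sigma * mu) + (sigma * mu) ^+ 2 / r ^+ 2.
  by field; rewrite gt_eqF.
have sm0 : 0 <= sigma * mu by rewrite mulr_ge0 // ltW.
have sm1 : sigma * mu <= mu by rewrite ler_piMl // ltW.
have : (sigma * mu) ^+ 2 / r ^+ 2 <= (1 - theta)^-1 * mu.
  rewrite ler_pdivrMr ?r2 //; apply: (@le_trans _ _ (mu * mu)).
    by rewrite expr2 ler_pM.
  by rewrite -[leRHS]mulrA ler_pdivlMl // mulrCA ler_pM2l.
by rewrite r2; lra.
Qed.

End Point.
End NormalEquations.

(** * Iteration count and conclusion *)

Lemma two_thirds_pow_le (R : realType) (k q : R) t : 0 < k -> 0 < q ->
  3 * (`|ln k| + 2 * Num.max 1 (ln q)) <= t%:R ->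
  (2 / 3) ^+ t * (k * q ^+ 2) <= 1.
Proof.
move=> k0 q0 ht.
(* From 1 + x <= exp x at x = -1/3; the rate 1/3 explains the factor 3 in the bound on [t]. *)
have h23 : 2 / 3 <= expR (- (1 / 3)) :> R.
  by apply: le_trans (expR_ge1Dx _); lra.
have pow : (2 / 3) ^+ t <= expR (- (1 / 3) * t%:R) :> R.
  by rewrite expRM_natr lerXn2r // ?nnegrE ?expR_ge0 //; lra.
have kq0 : 0 < k * q ^+ 2 by rewrite mulr_gt0 // exprn_gt0.
apply: le_trans (ler_wpM2r (ltW kq0) pow) _.
rewrite -{1}[k * _]lnK ?posrE // -expRD -[leRHS]expR0 ler_expR.
rewrite lnM ?posrE ?exprn_gt0 // lnXn //.
have m1 : ln q <= Num.max 1 (ln q) by rewrite le_max lexx orbT.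
have m2 : ln k <= `|ln k| by exact: ler_norm.
by rewrite -[ln q *+ 2]mulr_natl; lra.
Qed.

(* The constant hidden in the O depends only on theta and on a positive lower
   bound c for n * mu and for sigma_max(AD)^2 * n * mu. *)
Theorem lemma22 (R : realType) (theta c : R)
    (htheta : 0 < theta < 1) (hc : 0 < c) :
  exists C : R, 0 < C /\
  forall (m n : nat) (A : 'M[R]_(m, n)) (x s : 'cV[R]_n) (y : 'cV[R]_m)
    (sigma delta : R) (U : 'M[R]_m) (sv : 'rV[R]_m) (V : 'M[R]_(n, m)),
  let mu := duality_measure x s in
  let D := scaling x s in
  let p := normal_rhs A sigma x s in
  let M := A *m (D *m D) *m A^T in
  let sigma_max := max_entry sv in
  row_free A ->
  N2 theta (x, y, s) ->
  0 <= sigma <= 1 ->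
  0 < delta ->
  thin_svd (A *m D) U sv V ->
  c <= n%:R * mu ->
  c <= sigma_max ^+ 2 * (n%:R * mu) ->
  exists t0 : nat,
    t0%:R <= C * Num.max 1 (ln (sigma_max * n%:R * mu / delta)) /\
    forall (zeta eta : R) (d : measure_display) (T : measurableType d)
      (P : probability T R) (w : nat) (W : 'I_n -> 'I_w -> {RV P >-> R})
      (t : nat),
    0 < zeta < 1 ->
    0 <= eta <= 1 ->
    with_prob_at_least P (1 - eta) (fun omega =>
      let Wo := random_mx W omega in
      spectral_norm (V^T *m Wo *m Wo^T *m V - 1%:M) <= zeta / 2) ->
    (t0 <= t)%N ->
    with_prob_at_least P (1 - eta) (fun omega =>
      let dy := sketched_pcg (A *m D) (random_mx W omega) p t in
      mxnorm M (dy - invmx M *m p) <= delta /\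
      l2norm (M *m dy - p) <= delta).
Proof.
have [theta0 theta1] := andP htheta.
pose K := 1 + (1 - theta)^-1.
have K0 : 0 < K by rewrite addr_gt0 // invr_gt0 subr_gt0.
(* The count below is at most 3 |ln (K / c)| + 6 max(1, ln q) + 1, and max(1, ln q) >= 1 absorbs the
   first and last terms, with 7 = 6 + 1. *)
exists (7 + 3 * `|ln (K / c)|); split; first by rewrite ltr_wpDr // mulr_ge0.
move=> m n A x s y sigma delta U sv V mu D p M smax Afree [near pos] hsigma
  delta0 Fsvd cmu csmu.
have [x0 s0] : (forall i, 0 < x i 0) /\ (forall i, 0 < s i 0).
  by split=> i; case: (pos i).
have a0 : 0 < n%:R * mu by apply: lt_le_trans cmu.
have mu0 : 0 < mu.
  by rewrite ltNge; apply/negP => mu0; move: a0; rewrite ltNge mulr_ge0_le0.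
have smax0 : 0 < smax.
  rewrite lt_neqAle max_entry_ge0 andbT eq_sym; apply: contraTneq csmu => ->.
  by rewrite expr0n mul0r -ltNge.
set q := smax * n%:R * mu / delta.
have q0 : 0 < q by rewrite divr_gt0 // -mulrA mulr_gt0.
have k0 : 0 < K / c by rewrite divr_gt0.
set T0 := 3 * (`|ln (K / c)| + 2 * Num.max 1 (ln q)).
have mx1 : 1 <= Num.max 1 (ln q) by rewrite le_max lexx.
have T00 : 0 <= T0 by rewrite /T0; have := normr_ge0 (ln (K / c)); lra.
have /andP[T0le T0lt] := truncn_itv T00.
exists (Num.truncn T0).+1; split.
  rewrite -addn1 natrD; apply: le_trans (lerD T0le (lexx _)) _.
  have := ler_wpM2l (normr_ge0 (ln (K / c))) mx1.
  by rewrite /T0; nra.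
move=> zeta eta d T P w W t /andP[zeta0 zeta1] _ [E [mE PE EP]] ht.
(* The sketching event itself serves; the rest is deterministic on it. *)
exists E; split=> // omega Eomega; set Wo := random_mx W omega => dy.
have {EP Eomega} := EP _ Eomega; rewrite -/Wo => sketch.
set F := A *m D.
have ME : M = F *m F^T by rewrite /M /F trmx_mul tr_scaling !mulmxA.
have Mpd : posdefmx M by rewrite ME; apply/gram_posdefmx/row_free_scaling.
have Mu := posdefmx_unit Mpd.
set Q := F *m Wo *m Wo^T *m F^T.
have QT : Q^T = Q by rewrite /Q !trmx_mul !trmxK !mulmxA.
have Qclose z : `|dotp z (Q *m z) - dotp z (M *m z)| <= 2^-1 * dotp z (M *m z).
  rewrite ME; apply: le_trans (sketch_distortion Fsvd Wo z) _.
  rewrite -ME ler_wpM2r ?posdefmx_ge0 //; apply: le_trans sketch _; lra.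
have Qlo z : 2^-1 * dotp z (M *m z) <= dotp z (Q *m z).
  by have := Qclose z; rewrite ler_norml => /andP[]; lra.
have Qhi z : dotp z (Q *m z) <= 3 / 2 * dotp z (M *m z).
  by have := Qclose z; rewrite ler_norml => /andP[]; lra.
have lohi : 0 < (2^-1 : R) <= 3 / 2 by apply/andP; split; lra.
have := preconditioned_cg_convergence p t Mpd QT lohi Qlo Qhi.
have -> : 1 - 2^-1 / (3 / 2) = 2 / 3 :> R by field.
rewrite /= [in cg _]ME -[invsqrtmx Q *m _]/dy.
set e := dy - _ => conv.
have rhs : dotp p (invmx M *m p) <= K * (n%:R * mu).
  rewrite ME /p normal_rhsE //; apply: le_trans (dotp_invmx_gram_le _ _) _.
    by rewrite -ME.
  exact: (dotp_normal_rhs_le x0 s0 theta1 hsigma mu0 near).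
have ht' : T0 <= t%:R by apply: le_trans (ltW T0lt) _; rewrite ler_nat.
have := two_thirds_pow_le k0 q0 ht'.
have pow0 : 0 <= (2 / 3) ^+ t :> R by rewrite exprn_ge0 //; lra.
move/(ler_wpM2l pow0): rhs => /(le_trans conv) {}conv.
move: pow0 conv; move: ((2 / 3) ^+ t) => r r0 conv rq.
(* One inequality serves both tolerances: the energy bound uses c <= smax^2 n mu, the residual bound
   c <= n mu. *)
have rq' : r * (K / c * (smax * (n%:R * mu)) ^+ 2) <= delta ^+ 2.
  move: rq; rewrite /q -(mulrA smax) expr_div_n !mulrA ler_pdivrMr ?exprn_gt0 //.
  by rewrite mul1r.
have en : dotp e (M *m e) <= delta ^+ 2.
  apply: le_trans conv (le_trans _ rq'); rewrite ler_wpM2l //.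
  rewrite -[in leRHS]mulrA ler_pM2l // -ler_pdivrMl ?invr_gt0 // invrK exprMn.
  by rewrite expr2 [in leRHS]mulrA ler_pM2r.
have rn : smax ^+ 2 * dotp e (M *m e) <= delta ^+ 2.
  apply: le_trans (ler_wpM2l (sqr_ge0 _) conv) (le_trans _ rq').
  rewrite mulrCA ler_wpM2l // mulrCA -[in leRHS]mulrA ler_pM2l //.
  rewrite -ler_pdivrMl ?invr_gt0 // invrK exprMn mulrCA ler_wpM2l ?sqr_ge0 //.
  by rewrite expr2 ler_pM2r.
split.
  by rewrite mxnormE -(ger0_norm (ltW delta0)) -sqrtr_sqr; apply: ler_wsqrtr.
have -> : M *m dy - p = M *m e by rewrite mulmxBr mulKVmx.
rewrite l2normE -(ger0_norm (ltW delta0)) -sqrtr_sqr; apply: ler_wsqrtr.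
by apply: le_trans rn; rewrite ME; apply: (thin_svd_residual Fsvd e).
Qed.
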